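(* For $k\in\mathbb{N}_0$, we have $$\mathbb{H}^k[q^*,q]_{\mathrm{her}}=\sum_{\alpha\in\mathbb{N}_0^3,\ |\alpha|\le k+1}x^\alpha\,\mathbb{R}[x_0,x_1^2+x_2^2+x_3^2].$$
   Context: $\mathbb{H}$ is the algebra of quaternions $q=x_0+x_1\mathrm{i}+x_2\mathrm{j}+x_3\mathrm{k}$, identified with $(x_0,x_1,x_2,x_3)\in\mathbb{R}^4$, with conjugation $q^*=x_0-x_1\mathrm{i}-x_2\mathrm{j}-x_3\mathrm{k}$. All polynomials are regarded as elements of the algebra $C(\mathbb{H};\mathbb{H})$ of continuous $\mathbb{H}$-valued functions on $\mathbb{H}$, with pointwise operations and involution $f^*(q):=f(q)^*$. Let $\Sigma=\{1,\mathrm{i},\mathrm{j},\mathrm{k}\}$; for a set $F$, $\mathrm{span}_{\mathbb{H}}F$ is the set of finite sums of elements $afb$ with $a,b\in\mathbb{H}$, $f\in F$. Define $\mathbb{H}^0[q^*,q]=\mathrm{span}_{\mathbb{H}}\{(q^* )^mq^n: m,n\in\mathbb{N}_0\}$ and, for $k\in\mathbb{N}=\{1,2,\dots\}$, $$\mathbb{H}^k[q^*,q]=\mathrm{span}_{\mathbb{H}}\{(q^* )^{m_0}q^{n_0}\sigma_1(q^* )^{m_1}q^{n_1}\cdots\sigma_k(q^* )^{m_k}q^{n_k}: m_0,n_0,\dots,m_k,n_k\in\mathbb{N}_0,\ \sigma_1,\dots,\sigma_k\in\Sigma\}.$$ The hermitian part is $\mathbb{H}^k[q^*,q]_{\mathrm{her}}:=\{f\in\mathbb{H}^k[q^*,q]: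 f=f^*\}$. For $\alpha=(\alpha_1,\alpha_2,\alpha_3)\in\mathbb{N}_0^3$, $|\alpha|=\alpha_1+\alpha_2+\alpha_3$ and $x^\alpha=x_1^{\alpha_1}x_2^{\alpha_2}x_3^{\alpha_3}$. $\mathbb{R}[x_0,x_1^2+x_2^2+x_3^2]$ denotes the real algebra generated by $x_0$ and $x_1^2+x_2^2+x_3^2$. *)

(* Defs.v *)
From HB Require Import structures.
From mathcomp Require Import all_boot all_order all_algebra.
From mathcomp Require Import ring.
From mathcomp Require Import boolp classical_sets reals.
Set Implicit Arguments.
Unset Strict Implicit.
Unset Printing Implicit Defensive.
Import Order.TTheory GRing.Theory Num.Theory.
Local Open Scope classical_set_scope.
Local Open Scope ring_scope.

(* [Quat a b c d] is the quaternion a + b i + c j + d k. *)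
Record quat (R : Type) : Type := Quat { qx0 : R; qx1 : R; qx2 : R; qx3 : R }.

Section QuaternionRing.
Variable R : realType.
Implicit Types p q r : quat R.

Definition tuple_of_quat q := (qx0 q, qx1 q, qx2 q, qx3 q).
Definition quat_of_tuple (t : R * R * R * R) :=
  Quat t.1.1.1 t.1.1.2 t.1.2 t.2.

Lemma tuple_of_quatK : cancel tuple_of_quat quat_of_tuple.
Proof. by case. Qed.

HB.instance Definition _ := Choice.copy (quat R) (can_type tuple_of_quatK).

Definition quat_zero : quat R := Quat 0 0 0 0.
Definition quat_one : quat R := Quat 1 0 0 0.
Definition quat_opp p := Quat (- qx0 p) (- qx1 p) (- qx2 p) (- qx3 p).
Definition quat_add p q :=
  Quat (qx0 p + qx0 q) (qx1 p + qx1 q) (qx2 p + qx2 q) (qx3 p + qx3 q).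

Definition quat_mul p q :=
  Quat (qx0 p * qx0 q - qx1 p * qx1 q - qx2 p * qx2 q - qx3 p * qx3 q)
       (qx0 p * qx1 q + qx1 p * qx0 q + qx2 p * qx3 q - qx3 p * qx2 q)
       (qx0 p * qx2 q - qx1 p * qx3 q + qx2 p * qx0 q + qx3 p * qx1 q)
       (qx0 p * qx3 q + qx1 p * qx2 q - qx2 p * qx1 q + qx3 p * qx0 q).

Lemma quat_addA : associative quat_add.
Proof. by case=> ? ? ? ? [? ? ? ?] [? ? ? ?]; congr Quat => /=; ring. Qed.
Lemma quat_addC : commutative quat_add.
Proof. by case=> ? ? ? ? [? ? ? ?]; congr Quat => /=; ring. Qed.
Lemma quat_add0 : left_id quat_zero quat_add.
Proof. by case=> ? ? ? ?; congr Quat => /=; ring. Qed.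
Lemma quat_addN : left_inverse quat_zero quat_opp quat_add.
Proof. by case=> ? ? ? ?; congr Quat => /=; ring. Qed.

HB.instance Definition _ :=
  GRing.isZmodule.Build (quat R) quat_addA quat_addC quat_add0 quat_addN.

Lemma quat_mulA : associative quat_mul.
Proof. by case=> ? ? ? ? [? ? ? ?] [? ? ? ?]; congr Quat => /=; ring. Qed.
Lemma quat_mul1l : left_id quat_one quat_mul.
Proof. by case=> ? ? ? ?; congr Quat => /=; ring. Qed.
Lemma quat_mul1r : right_id quat_one quat_mul.
Proof. by case=> ? ? ? ?; congr Quat => /=; ring. Qed.
Lemma quat_mulDl : left_distributive quat_mul quat_add.
Proof. by case=> ? ? ? ? [? ? ? ?] [? ? ? ?]; congr Quat => /=; ring. Qed.
Lemma quat_mulDr : right_distributive quat_mul quat_add.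
Proof. by case=> ? ? ? ? [? ? ? ?] [? ? ? ?]; congr Quat => /=; ring. Qed.
Lemma quat_one_neq0 : quat_one != 0.
Proof. by apply/eqP => -[] /eqP; rewrite oner_eq0. Qed.

HB.instance Definition _ := GRing.Zmodule_isNzRing.Build (quat R)
  quat_mulA quat_mul1l quat_mul1r quat_mulDl quat_mulDr quat_one_neq0.

End QuaternionRing.

Section QuaternionicPolynomials.
Variable R : realType.
Implicit Types (q : quat R) (f g : quat R -> quat R).

Definition quat_conj q : quat R := Quat (qx0 q) (- qx1 q) (- qx2 q) (- qx3 q).
Definition quat_real (a : R) : quat R := Quat a 0 0 0.
Definition quat_i : quat R := Quat 0 1 0 0.
Definition quat_j : quat R := Quat 0 0 1 0.
Definition quat_k : quat R := Quat 0 0 0 1.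

Definition Sigma : set (quat R) :=
  [set s | [\/ s = 1, s = quat_i, s = quat_j | s = quat_k]].

(* The algebra C(H;H) enters only through its pointwise operations and equality
   of functions: every set below consists of polynomial, hence continuous,
   functions, so no continuity condition is imposed. *)
Definition fun_conj f : quat R -> quat R := fun q => quat_conj (f q).

Definition spanH (F : set (quat R -> quat R)) : set (quat R -> quat R) :=
  [set f | exists (n : nat) (a b : 'I_n -> quat R)
             (g : 'I_n -> quat R -> quat R),
     (forall i, F (g i)) /\ f = (fun q => \sum_(i < n) a i * g i q * b i)].

(* The product is the ordered one; since [lift ord0 i] is the index i + 1, the
   i-th factor is sigma_(i+1) (q^* )^(m_(i+1)) q^(n_(i+1)).  For k = 0 the
   product is empty, leaving (q^* )^(m_0) q^(n_0). *)
Definition word (k : nat) (m n : 'I_k.+1 -> nat) (s : 'I_k -> quat R) :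
    quat R -> quat R :=
  fun q => quat_conj q ^+ m ord0 * q ^+ n ord0 *
    \prod_(i < k) (s i * quat_conj q ^+ m (lift ord0 i) * q ^+ n (lift ord0 i)).

Definition Hpoly (k : nat) : set (quat R -> quat R) :=
  spanH [set f | exists (m n : 'I_k.+1 -> nat) (s : 'I_k -> quat R),
           (forall i, Sigma (s i)) /\ f = word m n s].

Definition Hpoly_her (k : nat) : set (quat R -> quat R) :=
  [set f | Hpoly k f /\ f = fun_conj f].

(* The (unital) real subalgebra generated by G; real scalars act through the
   constant functions with values in the copy of R inside the quaternions. *)
Inductive real_algebra (G : set (quat R -> quat R)) :
    (quat R -> quat R) -> Prop :=
| real_algebra_gen f : G f -> real_algebra G f
| real_algebra_const (a : R) : real_algebra G (fun _ => quat_real a)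
| real_algebra_add f g : real_algebra G f -> real_algebra G g ->
    real_algebra G (fun q => f q + g q)
| real_algebra_mul f g : real_algebra G f -> real_algebra G g ->
    real_algebra G (fun q => f q * g q).

Definition axial_algebra : set (quat R -> quat R) :=
  real_algebra [set f | f = (fun q => quat_real (qx0 q)) \/
    f = (fun q => quat_real (qx1 q ^+ 2 + qx2 q ^+ 2 + qx3 q ^+ 2))].

Definition vec_monomial (a1 a2 a3 : nat) : quat R -> quat R :=
  fun q => quat_real (qx1 q ^+ a1 * qx2 q ^+ a2 * qx3 q ^+ a3).

(* The sum of the spaces x^alpha R[x0, x1^2 + x2^2 + x3^2] over |alpha| <= d:
   the bounds a_i < d.+1 only make the index set finite. *)
Definition axial_sum (d : nat) : set (quat R -> quat R) :=
  [set f | exists h : nat -> nat -> nat -> quat R -> quat R,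
     (forall a1 a2 a3, (a1 + a2 + a3 <= d)%N -> axial_algebra (h a1 a2 a3)) /\
     f = (fun q => \sum_(a1 < d.+1) \sum_(a2 < d.+1)
       \sum_(a3 < d.+1 | (a1 + a2 + a3 <= d)%N)
         vec_monomial a1 a2 a3 q * h a1 a2 a3 q)].

End QuaternionicPolynomials.

Arguments Hpoly_her : clear implicits.
Arguments axial_sum : clear implicits.

(* Main.v *)
Require Import Defs.
From mathcomp Require Import all_boot all_order all_algebra.
From mathcomp Require Import ring zify.
From mathcomp Require Import boolp classical_sets reals.
Set Implicit Arguments.
Unset Strict Implicit.
Unset Printing Implicit Defensive.
Import GRing.Theory Num.Theory.
Local Open Scope classical_set_scope.
Local Open Scope ring_scope.

(** Write q = x0 + v with v = x1 i + x2 j + x3 k, and let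
    A = R[x0, x1^2 + x2^2 + x3^2].  Each (q^* )^m q^n lies in the commutative
    algebra A + v A, because v^2 = - (x1^2 + x2^2 + x3^2); hence the components
    of a product of k + 1 such factors, interlaced with constants, have degree
    at most k + 1 in x1, x2, x3 over A.  Conversely
    Re p = (p - i p i - j p j - k p k) / 4 lies in the H-bimodule generated by
    p, so x1 = - Re (i q) and its analogues belong to H^0[q^*, q], and the
    product of k + 1 elements of H^0[q^*, q] belongs to H^k[q^*, q]. *)

(** * Real scalars, conjugation and real parts of quaternions *)

Section QuaternionIdentities.
Variable R : realType.
Implicit Types (a b : R) (p q : quat R).

Lemma quatP p q : qx0 p = qx0 q -> qx1 p = qx1 q -> qx2 p = qx2 q ->
  qx3 p = qx3 q -> p = q.
Proof. by case: p => ? ? ? ?; case: q => ? ? ? ? /= -> -> -> ->. Qed.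

Lemma quat_real1 : quat_real 1 = 1 :> quat R.
Proof. by []. Qed.

Lemma quat_realD a b : quat_real (a + b) = quat_real a + quat_real b.
Proof. by apply: quatP => /=; ring. Qed.

Lemma quat_realM a b : quat_real (a * b) = quat_real a * quat_real b.
Proof. by apply: quatP => /=; ring. Qed.

Lemma quat_real_comm a p : GRing.comm (quat_real a) p.
Proof. by apply: quatP => /=; ring. Qed.

Lemma quat_real_mulCA a p q : quat_real a * (p * q) = p * (quat_real a * q).
Proof. by rewrite !mulrA quat_real_comm. Qed.

Lemma quat_conj_comm q : GRing.comm q (quat_conj q).
Proof. by apply: quatP => /=; ring. Qed.

Lemma quat_real_re q : q = quat_conj q -> q = quat_real (qx0 q).
Proof.
case: q => x0 x1 x2 x3 [] h1 h2 h3.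
have opp_eq0 (x : R) : x = - x -> x = 0.
  move=> h; have /eqP: x *+ 2 = 0 by rewrite mulr2n {1}h addNr.
  by rewrite mulrn_eq0 => /eqP.
by apply: quatP => //=; apply: opp_eq0.
Qed.

(** Since the inverse of i is -i, the map p -> - i p i is conjugation by i: it keeps the real and i
    coordinates and negates the other two; likewise for j and k. In the sum of p and its three
    conjugates every imaginary coordinate cancels and the real one is counted four times. *)
Lemma quat_re_sandwich q : quat_real (qx0 q) =
  quat_real 4^-1 * q * 1 + (quat_real (- 4^-1) * quat_i R) * q * quat_i R +
  (quat_real (- 4^-1) * quat_j R) * q * quat_j R +
  (quat_real (- 4^-1) * quat_k R) * q * quat_k R.
Proof. by apply: quatP => /=; field. Qed.

Lemma quat_basis q : q =
  quat_real (qx0 q) * 1 + quat_real (qx1 q) * quat_i R +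
  quat_real (qx2 q) * quat_j R + quat_real (qx3 q) * quat_k R.
Proof. by apply: quatP => /=; ring. Qed.

End QuaternionIdentities.

(** * Closure properties of the two-sided quaternionic span *)

Section BimoduleSpan.
Variables (R : realType) (F : set (quat R -> quat R)).
Implicit Types (c d : quat R) (f g : quat R -> quat R).

(** Trades the indexed families in [spanH] for closure conditions on [P]; the inclusions out of a
    span below go through this principle. *)
Lemma spanH_ind (P : set (quat R -> quat R)) :
  P (fun=> 0) -> (forall f g, P f -> P g -> P (fun q => f q + g q)) ->
  (forall a b f, F f -> P (fun q => a * f q * b)) -> spanH F `<=` P.
Proof.
move=> P0 PD PF _ [n [a [b [g [Fg ->]]]]].
elim: n a b g Fg => [|n IHn] a b g Fg.
  rewrite (_ : (fun _ => _) = fun=> 0) //.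
  by apply/funext=> q; rewrite big_ord0.
rewrite (_ : (fun _ => _) = fun q =>
  \sum_(i < n) a (lift ord0 i) * g (lift ord0 i) q * b (lift ord0 i) +
  a ord0 * g ord0 q * b ord0); last first.
  by apply/funext => q; rewrite big_ord_recl addrC.
by apply: PD; [apply: IHn => i|]; last exact: PF.
Qed.

Lemma spanH_gen a b f : F f -> spanH F (fun q => a * f q * b).
Proof.
move=> Ff; exists 1%N, (fun=> a), (fun=> b), (fun=> f); split=> //.
by apply/funext => q; rewrite big_ord1.
Qed.

Lemma spanH0 : spanH F (fun=> 0).
Proof.
exists 0%N, (fun=> 0), (fun=> 0), (fun=> fun=> 0); split=> [[]//|].
by apply/funext => q; rewrite big_ord0.
Qed.

Lemma spanHD f g : spanH F f -> spanH F g -> spanH F (fun q => f q + g q).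
Proof.
case=> [n1 [a1 [b1 [g1 [Fg1 ->]]]]] [n2 [a2 [b2 [g2 [Fg2 ->]]]]].
pose pair (T : Type) (u1 : 'I_n1 -> T) u2 (i : 'I_(n1 + n2)) :=
  match split i with inl j => u1 j | inr j => u2 j end.
exists (n1 + n2)%N, (pair _ a1 a2), (pair _ b1 b2), (pair _ g1 g2); split.
  by move=> i; rewrite /pair; case: (split i).
apply/funext => q; rewrite big_split_ord /pair /=.
by congr (_ + _); apply: eq_bigr => i _;
  rewrite ?(unsplitK (inl i)) ?(unsplitK (inr i)).
Qed.

Lemma spanH_sum (I : Type) (r : seq I) (P : pred I)
    (f : I -> quat R -> quat R) :
  (forall i, P i -> spanH F (f i)) ->
  spanH F (fun q => \sum_(i <- r | P i) f i q).
Proof.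
move=> Ff; elim: r => [|i r IHr].
  by under eq_fun do rewrite big_nil; exact: spanH0.
under eq_fun do rewrite big_cons; case: (boolP (P i)) => // Pi.
by apply: spanHD => //; exact: Ff.
Qed.

Lemma spanHM c d f : spanH F f -> spanH F (fun q => c * f q * d).
Proof.
move: f; apply: spanH_ind => [|f g Ff Fg|a b f Ff].
- by rewrite (_ : (fun _ => _) = fun=> 0) ?mulr0 ?mul0r //; exact: spanH0.
- rewrite (_ : (fun _ => _) = fun q => c * f q * d + c * g q * d).
    exact: spanHD.
  by apply/funext => q; rewrite mulrDr mulrDl.
- rewrite (_ : (fun _ => _) = fun q => (c * a) * f q * (b * d)).
    exact: spanH_gen.
  by apply/funext => q; rewrite !mulrA.
Qed.

(** The sandwich identity writes the real part as a two-sided combination of f with constant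
    coefficients, so any bimodule contains it. *)
Lemma spanH_re f : spanH F f -> spanH F (fun q => quat_real (qx0 (f q))).
Proof.
move=> Ff; rewrite (_ : (fun _ => _) = fun q =>
  quat_real 4^-1 * f q * 1 + (quat_real (- 4^-1) * quat_i R) * f q * quat_i R +
  (quat_real (- 4^-1) * quat_j R) * f q * quat_j R +
  (quat_real (- 4^-1) * quat_k R) * f q * quat_k R); last first.
  by apply/funext => q; exact: quat_re_sandwich.
by do 3?[apply: spanHD; last exact: spanHM]; exact: spanHM.
Qed.

End BimoduleSpan.

(** * The coefficient algebra A and its extension A + v A *)

Section AxialAlgebra.
Variable R : realType.
Implicit Types (f g : quat R -> quat R) (u v : quat R -> R).

(** Elements of A seen as real-valued functions, so that coefficients can be computed in the
    commutative field [R]; [axial_algebra_real] shows that every element of A has this form. *)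
Definition axial u := axial_algebra (fun q => quat_real (u q)).

Definition normv (q : quat R) := qx1 q ^+ 2 + qx2 q ^+ 2 + qx3 q ^+ 2.

Lemma axial_const a : axial (fun=> a).
Proof. exact: real_algebra_const. Qed.

Lemma axial_x0 : axial (@qx0 R).
Proof. by apply: real_algebra_gen; left. Qed.

Lemma axial_normv : axial normv.
Proof. by apply: real_algebra_gen; right. Qed.

Lemma axialD u v : axial u -> axial v -> axial (fun q => u q + v q).
Proof.
move=> Au Av; rewrite /axial.
under eq_fun do rewrite quat_realD.
exact: real_algebra_add.
Qed.

Lemma axialM u v : axial u -> axial v -> axial (fun q => u q * v q).
Proof.
move=> Au Av; rewrite /axial.
under eq_fun do rewrite quat_realM.
exact: real_algebra_mul.
Qed.

Lemma axialN u : axial u -> axial (fun q => - u q).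
Proof.
move=> Au; under eq_fun do rewrite -mulN1r.
by apply: axialM => //; exact: axial_const.
Qed.

Lemma axial_algebra_real f : axial_algebra f ->
  forall q, f q = quat_real (qx0 (f q)).
Proof.
elim=> {f} [f [->|->]|a|f g _ IHf _ IHg|f g _ IHf _ IHg] q //.
- by rewrite [in LHS]IHf [in LHS]IHg -quat_realD.
- rewrite [in LHS]IHf [in LHS]IHg -quat_realM; congr quat_real.
  by rewrite [in RHS]IHf [in RHS]IHg -quat_realM.
Qed.

(* The commutative algebra A + v A. *)
Definition axial_quat f := exists u v, [/\ axial u, axial v &
  f = fun q => Quat (u q) (qx1 q * v q) (qx2 q * v q) (qx3 q * v q)].

Lemma axial_quat1 : axial_quat (fun=> 1).
Proof.
exists (fun=> 1), (fun=> 0); split; [exact: axial_const..|].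
by apply/funext => q; apply: quatP => /=; ring.
Qed.

Lemma axial_quatM f g :
  axial_quat f -> axial_quat g -> axial_quat (fun q => f q * g q).
Proof.
move=> [u1 [v1 [Au1 Av1 ->]]] [u2 [v2 [Au2 Av2 ->]]].
(* Coefficients of (u1 + v1 v)(u2 + v2 v), reduced by v^2 = - [normv]. *)
exists (fun q => u1 q * u2 q + - (normv q * (v1 q * v2 q))),
  (fun q => u1 q * v2 q + v1 q * u2 q); split.
- apply: axialD; [|apply: axialN]; do !apply: axialM => //.
  exact: axial_normv.
- by apply: axialD; apply: axialM.
- by apply/funext => q; apply: quatP => /=; rewrite /normv; ring.
Qed.

Lemma axial_quatX f n : axial_quat f -> axial_quat (fun q => f q ^+ n).
Proof.
move=> Af; elim: n => [|n IHn]; first exact: axial_quat1.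
by under eq_fun do rewrite exprS; exact: axial_quatM.
Qed.

Lemma axial_quat_id : axial_quat id.
Proof.
exists (@qx0 R), (fun=> 1); split; [exact: axial_x0|exact: axial_const|].
by apply/funext => q; apply: quatP => /=; ring.
Qed.

Lemma axial_quat_conj : axial_quat (@quat_conj R).
Proof.
exists (@qx0 R), (fun=> -1); split; [exact: axial_x0|exact: axial_const|].
by apply/funext => q; apply: quatP => /=; ring.
Qed.

End AxialAlgebra.

(** * Filtration by the degree in x1, x2, x3 over A *)

Section AxialSpan.
Variable R : realType.
Implicit Types (f g : quat R -> quat R) (u v : quat R -> R).

(** Real-valued counterpart of [axial_sum], given by closure under sums so that products can be
    treated by induction; [axial_sum_span] returns to the indexed form. *)
Inductive axial_span (d : nat) : (quat R -> R) -> Prop :=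
| axial_span_monomial a1 a2 a3 u : (a1 + a2 + a3 <= d)%N -> axial u ->
    axial_span d (fun q => qx1 q ^+ a1 * qx2 q ^+ a2 * qx3 q ^+ a3 * u q)
| axial_span_add u v : axial_span d u -> axial_span d v ->
    axial_span d (fun q => u q + v q).

Lemma axial_span_axial d u : axial u -> axial_span d u.
Proof.
move=> Au; rewrite (_ : u = fun q =>
  qx1 q ^+ 0 * qx2 q ^+ 0 * qx3 q ^+ 0 * u q).
  exact: axial_span_monomial.
by apply/funext => q; rewrite !expr0 !mul1r.
Qed.

Lemma axial_spanM d e u v :
  axial_span d u -> axial_span e v -> axial_span (d + e) (fun q => u q * v q).
Proof.
move=> Su; elim=> {v} [b1 b2 b3 v bd Av|v w _ IHv _ IHw]; last first.
  by under eq_fun do rewrite mulrDr; exact: axial_span_add.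
elim: Su => {u} [a1 a2 a3 u ad Au|u w _ IHu _ IHw]; last first.
  by under eq_fun do rewrite mulrDl; exact: axial_span_add.
rewrite (_ : (fun _ => _) = fun q =>
  qx1 q ^+ (a1 + b1) * qx2 q ^+ (a2 + b2) * qx3 q ^+ (a3 + b3) * (u q * v q)).
  by apply: axial_span_monomial; [lia|exact: axialM].
by apply/funext => q; rewrite !exprD; ring.
Qed.

Lemma axial_spanN d u : axial_span d u -> axial_span d (fun q => - u q).
Proof.
move=> Su; under eq_fun do rewrite -mulN1r.
by apply: (@axial_spanM 0%N) => //; apply/axial_span_axial/axial_const.
Qed.

Lemma axial_sum_span d u :
  axial_span d u -> axial_sum R d (fun q => quat_real (u q)).
Proof.
elim=> {u} [b1 b2 b3 u bd Au|u v _ [h1 [Ah1 Eu]] _ [h2 [Ah2 Ev]]]; last first.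
  exists (fun a1 a2 a3 q => h1 a1 a2 a3 q + h2 a1 a2 a3 q); split.
    by move=> *; apply: real_algebra_add; [exact: Ah1|exact: Ah2].
  apply/funext => q; rewrite quat_realD.
  rewrite (congr1 (@^~ q) Eu) (congr1 (@^~ q) Ev) /=.
  do 3!(rewrite -big_split; apply: eq_bigr => ? _).
  by rewrite mulrDr.
(* A single monomial is the triple sum whose coefficient family is u at (b1, b2, b3) and 0
   elsewhere. The degree bound puts each b_i in the index range, and every other term vanishes
   because one coordinate of its index differs. *)
exists (fun a1 a2 a3 q => quat_real
  (if [&& a1 == b1, a2 == b2 & a3 == b3] then u q else 0)); split.
  move=> a1 a2 a3 _; case: [&& a1 == b1, a2 == b2 & a3 == b3] => //.
  exact: axial_const.
apply/funext => q.
have [l1 l2 l3] : [/\ b1 < d.+1, b2 < d.+1 & b3 < d.+1]%N by split; lia.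
rewrite (bigD1 (Ordinal l1)) //= (bigD1 (Ordinal l2)) //=.
rewrite (bigD1 (Ordinal l3)) //= !eqxx /= big1 => [|i /andP[_ ni]]; last first.
  rewrite (_ : (_ == b3) = false) ?mulr0 //.
  by apply/eqP => e; case/eqP: ni; exact: val_inj.
rewrite big1 => [|j nj]; last first.
  apply: big1 => i _; rewrite (_ : (_ == b2) = false) ?mulr0 //.
  by apply/eqP => e; case/eqP: nj; exact: val_inj.
rewrite big1 => [|l nl]; last first.
  apply: big1 => j _; apply: big1 => i _.
  rewrite (_ : (_ == b1) = false) ?mulr0 //.
  by apply/eqP => e; case/eqP: nl; exact: val_inj.
by rewrite !addr0 quat_realM.
Qed.

Definition quat_span d f := [/\ axial_span d (fun q => qx0 (f q)),
  axial_span d (fun q => qx1 (f q)), axial_span d (fun q => qx2 (f q)) &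
  axial_span d (fun q => qx3 (f q))].

Lemma quat_span_const d c : quat_span d (fun=> c).
Proof. by split; apply/axial_span_axial/axial_const. Qed.

Lemma quat_spanD d f g :
  quat_span d f -> quat_span d g -> quat_span d (fun q => f q + g q).
Proof. by move=> [? ? ? ?] [? ? ? ?]; split; exact: axial_span_add. Qed.

Lemma quat_spanM d e f g :
  quat_span d f -> quat_span e g -> quat_span (d + e) (fun q => f q * g q).
Proof.
by move=> [? ? ? ?] [? ? ? ?]; split;
  do ![apply: axial_span_add | apply: axial_spanN]; apply: axial_spanM.
Qed.

(** The components of u + v_0 v, with u and v_0 in A, are u and the x_i v_0. Hence the degree over A
    is at most 1 however large the exponents of q and its conjugate are. *)
Lemma quat_span_axial f : axial_quat f -> quat_span 1 f.
Proof.
move=> [u [v [Au Av ->]]]; split => /=; first exact: axial_span_axial.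
- by have := @axial_span_monomial 1 1 0 0 v isT Av;
    under eq_fun do rewrite expr1 !expr0 !mulr1.
- by have := @axial_span_monomial 1 0 1 0 v isT Av;
    under eq_fun do rewrite expr1 !expr0 mulr1 mul1r.
- by have := @axial_span_monomial 1 0 0 1 v isT Av;
    under eq_fun do rewrite expr1 !expr0 mul1r mul1r.
Qed.

Lemma quat_span_monomial m n :
  quat_span 1 (fun q => quat_conj q ^+ m * q ^+ n).
Proof.
apply/quat_span_axial/axial_quatM; apply: axial_quatX.
  exact: axial_quat_conj.
exact: axial_quat_id.
Qed.

End AxialSpan.

(** * Degree bound for words and for H^k *)

Section Words.
Variable R : realType.
Implicit Types (f g : quat R -> quat R) (u : quat R -> R).

Lemma word0 (m n : 'I_1 -> nat) (s : 'I_0 -> quat R) :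
  word m n s = fun q => quat_conj q ^+ m ord0 * q ^+ n ord0.
Proof. by apply/funext => q; rewrite /word big_ord0 mulr1. Qed.

Lemma word_recl k (m n : 'I_k.+2 -> nat) (s : 'I_k.+1 -> quat R) :
  word m n s = fun q => quat_conj q ^+ m ord0 * q ^+ n ord0 *
    (s ord0 * word (m \o lift ord0) (n \o lift ord0) (s \o lift ord0) q).
Proof. by apply/funext => q; rewrite /word big_ord_recl !mulrA. Qed.

(** Each of the k + 1 blocks of powers contributes degree 1, and each constant between them
    contributes degree 0. *)
Lemma quat_span_word k (m n : 'I_k.+1 -> nat) (s : 'I_k -> quat R) :
  quat_span k.+1 (word m n s).
Proof.
elim: k m n s => [|k IHk] m n s.
  by rewrite word0; exact: quat_span_monomial.
rewrite word_recl; apply: (@quat_spanM _ 1); first exact: quat_span_monomial.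
by apply: (@quat_spanM _ 0) => //; exact: quat_span_const.
Qed.

Lemma quat_span_Hpoly k f : Hpoly k f -> quat_span k.+1 f.
Proof.
move: f; apply: spanH_ind => [|f g|a b _ [m [n [s [_ ->]]]]].
- exact: quat_span_const.
- exact: quat_spanD.
- rewrite -[k.+1]addn0; apply: quat_spanM; last exact: quat_span_const.
  by apply: (@quat_spanM _ 0); [exact: quat_span_const|exact: quat_span_word].
Qed.

(** * Products with H^0, and H^0 as a module over A *)

Lemma Hpoly0_monomial a b m n :
  Hpoly 0 (fun q : quat R => a * (quat_conj q ^+ m * q ^+ n) * b).
Proof.
apply: spanH_gen; exists (fun=> m), (fun=> n), (fun=> 1); split=> [[]//|].
by rewrite word0.
Qed.

Lemma Hpoly0_ind (P : set (quat R -> quat R)) :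
  P (fun=> 0) -> (forall f g, P f -> P g -> P (fun q => f q + g q)) ->
  (forall a b m n, P (fun q => a * (quat_conj q ^+ m * q ^+ n) * b)) ->
  Hpoly 0 `<=` P.
Proof.
move=> P0 PD PF; apply: spanH_ind => // a b _ [m [n [s [_ ->]]]].
by rewrite word0.
Qed.

(** Multiplying two generators leaves an arbitrary constant b c between a block and a word.
    Expanding it in the basis 1, i, j, k gives four longer words, each with a basis element as its
    new first letter. *)
Lemma Hpoly0M k f g :
  Hpoly 0 f -> Hpoly k g -> Hpoly k.+1 (fun q => f q * g q).
Proof.
move=> + Hg; move: f; apply: Hpoly0_ind => [|f f' Hf Hf'|a b m n].
- by under eq_fun do rewrite mul0r; exact: spanH0.
- by under eq_fun do rewrite mulrDl; exact: spanHD.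
move: g Hg; apply: spanH_ind => [|g g' Hg Hg'|c d _ [m' [n' [s [Ss ->]]]]].
- by under eq_fun do rewrite mulr0; exact: spanH0.
- by under eq_fun do rewrite mulrDr; exact: spanHD.
have Hsigma t : Sigma t -> Hpoly k.+1
    (fun q => a * (quat_conj q ^+ m * q ^+ n * (t * word m' n' s q)) * d).
  move=> St; apply: spanH_gen.
  (* Prepends one entry to a finite family; the exponents and letters of the longer word are built
     with it. *)
  pose cons (T : Type) (x0 : T) l (x : 'I_l -> T) (i : 'I_l.+1) :=
    if unlift ord0 i is Some j then x j else x0.
  have cons0 T x0 l x : @cons T x0 l x ord0 = x0 by rewrite /cons unlift_none.
  have consS T x0 l x : @cons T x0 l x \o lift ord0 = x.
    by apply/funext => i; rewrite /cons /= liftK.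
  exists (cons _ m _ m'), (cons _ n _ n'), (cons _ t _ s); split.
    by move=> i; rewrite /cons; case: (unlift ord0 i).
  by rewrite word_recl !cons0 !consS.
rewrite (_ : (fun _ => _) = fun q =>
  quat_real (qx0 (b * c)) * (a * (quat_conj q ^+ m * q ^+ n *
    (1 * word m' n' s q)) * d) * 1 +
  quat_real (qx1 (b * c)) * (a * (quat_conj q ^+ m * q ^+ n *
    (quat_i R * word m' n' s q)) * d) * 1 +
  quat_real (qx2 (b * c)) * (a * (quat_conj q ^+ m * q ^+ n *
    (quat_j R * word m' n' s q)) * d) * 1 +
  quat_real (qx3 (b * c)) * (a * (quat_conj q ^+ m * q ^+ n *
    (quat_k R * word m' n' s q)) * d) * 1).
  by do 3?[apply: spanHD; last (apply: spanHM; apply: Hsigma);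
    last by [apply: Or42 | apply: Or43 | apply: Or44]];
    apply: spanHM; apply: Hsigma; apply: Or41.
apply/funext => q; set p := _ ^+ m * _; set w := word m' n' s q.
clearbody p w.
(* The real coordinates of b c are central, so they can be moved inwards next to their basis
   elements, where the four terms recombine to b c. *)
have shift (r : R) x :
    quat_real r * (a * (p * (x * w)) * d) * 1 =
    a * p * (quat_real r * x) * w * d.
  by rewrite mulr1 -!mulrA (quat_real_mulCA r a) (quat_real_mulCA r p).
by rewrite 4!shift -6!mulrDl -3!mulrDr -(quat_basis (b * c)) !mulrA.
Qed.

Lemma Hpoly0_1 : Hpoly 0 (fun=> 1 : quat R).
Proof.
have := Hpoly0_monomial 1 1 0 0.
by under eq_fun do rewrite !expr0 !mulr1.
Qed.

Lemma Hpoly0_id : Hpoly 0 (@id (quat R)).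
Proof.
have := Hpoly0_monomial 1 1 0 1.
by under eq_fun do rewrite expr0 expr1 mulr1 !mul1r.
Qed.

(** Twice x0 is q plus its conjugate. This sum is real, hence passes through the left constant, and
    multiplying by it raises one of the two exponents by 1 in each summand. *)
Lemma Hpoly0_x0M f :
  Hpoly 0 f -> Hpoly 0 (fun q => quat_real (qx0 q) * f q).
Proof.
move: f; apply: Hpoly0_ind => [|f g Hf Hg|a b m n].
- by under eq_fun do rewrite mulr0; exact: spanH0.
- by under eq_fun do rewrite mulrDr; exact: spanHD.
rewrite (_ : (fun _ => _) = fun q =>
  quat_real 2^-1 * (a * (quat_conj q ^+ m.+1 * q ^+ n) * b) * 1 +
  quat_real 2^-1 * (a * (quat_conj q ^+ m * q ^+ n.+1) * b) * 1).
  by apply: spanHD; apply: spanHM; exact: Hpoly0_monomial.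
apply/funext => q.
have -> : quat_real (qx0 q) = quat_real 2^-1 * (quat_conj q + q).
  by apply: quatP => /=; field.
have comm_re : GRing.comm (quat_conj q + q) a.
  by apply: quatP => /=; ring.
rewrite !mulr1 -mulrDr -mulrDl -mulrDr -mulrA; congr (_ * _).
rewrite !mulrA comm_re -!mulrA; congr (_ * _); rewrite !mulrA; congr (_ * _).
by rewrite !mulrDl exprS exprS !mulrA (commrX m (quat_conj_comm q)).
Qed.

(** The factor is the squared norm of q, the product of q and its conjugate: it is central and
    raises both exponents by 1. Subtracting x0^2 then gives the action of the second generator of
    A. *)
Lemma Hpoly0_normM f :
  Hpoly 0 f -> Hpoly 0 (fun q => quat_real (qx0 q ^+ 2 + normv q) * f q).
Proof.
move: f; apply: Hpoly0_ind => [|f g Hf Hg|a b m n].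
- by under eq_fun do rewrite mulr0; exact: spanH0.
- by under eq_fun do rewrite mulrDr; exact: spanHD.
rewrite (_ : (fun _ => _) = fun q =>
  a * (quat_conj q ^+ m.+1 * q ^+ n.+1) * b); first exact: Hpoly0_monomial.
apply/funext => q; rewrite -!mulrA quat_real_mulCA; congr (_ * _).
have -> : quat_real (qx0 q ^+ 2 + normv q) = quat_conj q * q.
  by apply: quatP; rewrite /= /normv; ring.
by rewrite !exprS -!mulrA (mulrA q) (commrX m (quat_conj_comm q)) -!mulrA.
Qed.

Lemma Hpoly0_normvM f :
  Hpoly 0 f -> Hpoly 0 (fun q => quat_real (normv q) * f q).
Proof.
move=> Hf; rewrite (_ : (fun _ => _) = fun q =>
  quat_real (qx0 q ^+ 2 + normv q) * f q +
  (-1) * (quat_real (qx0 q) * (quat_real (qx0 q) * f q)) * 1).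
  apply: spanHD; first exact: Hpoly0_normM.
  by apply: spanHM; do 2!apply: Hpoly0_x0M.
apply/funext => q; rewrite (quat_realD (qx0 q ^+ 2)) quat_realM.
by rewrite mulN1r mulr1 mulrDl -mulrA addrAC subrr add0r.
Qed.

Lemma Hpoly0_axialM g f :
  axial_algebra g -> Hpoly 0 f -> Hpoly 0 (fun q => g q * f q).
Proof.
move=> Ag; elim: Ag f => {g} [g [->|->]|r|g h _ IHg _ IHh|g h _ IHg _ IHh] f Hf.
- exact: Hpoly0_x0M.
- exact: Hpoly0_normvM.
- have := spanHM (quat_real r) 1 Hf; congr (Hpoly 0 _).
  by apply/funext => q; rewrite mulr1.
- by under eq_fun do rewrite mulrDl; apply: spanHD; [exact: IHg|exact: IHh].
- by under eq_fun do rewrite -mulrA; apply/IHg/IHh.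
Qed.

(** * Vector coordinates and monomials inside H^k, and realness of the axial sum *)

Lemma Hpoly0_vec : [/\ Hpoly 0 (fun q : quat R => quat_real (qx1 q)),
  Hpoly 0 (fun q : quat R => quat_real (qx2 q)) &
  Hpoly 0 (fun q : quat R => quat_real (qx3 q))].
Proof.
split.
- rewrite (_ : (fun _ => _) = fun q => quat_real (qx0 (- quat_i R * q * 1))).
    by apply: spanH_re; apply: spanHM; exact: Hpoly0_id.
  by apply/funext => q; congr quat_real => /=; ring.
- rewrite (_ : (fun _ => _) = fun q => quat_real (qx0 (- quat_j R * q * 1))).
    by apply: spanH_re; apply: spanHM; exact: Hpoly0_id.
  by apply/funext => q; congr quat_real => /=; ring.
- rewrite (_ : (fun _ => _) = fun q => quat_real (qx0 (- quat_k R * q * 1))).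
    by apply: spanH_re; apply: spanHM; exact: Hpoly0_id.
  by apply/funext => q; congr quat_real => /=; ring.
Qed.

(** A monomial of degree at most k + 1 splits into at most k + 1 coordinates, each in H^0; the
    coefficient h is absorbed by the last factor, since H^0 is an A-module. *)
Lemma Hpoly_vec_monomialM k a1 a2 a3 (h : quat R -> quat R) :
  (a1 + a2 + a3 <= k.+1)%N -> axial_algebra h ->
  Hpoly k (fun q => vec_monomial a1 a2 a3 q * h q).
Proof.
move=> ak Ah; have [H1 H2 H3] := Hpoly0_vec.
have vec1 b1 b2 b3 : (fun q => vec_monomial b1.+1 b2 b3 q * h q) =
    fun q => quat_real (qx1 q) * (vec_monomial b1 b2 b3 q * h q).
  by apply/funext => q; rewrite /vec_monomial mulrA -quat_realM exprS !mulrA.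
have vec2 b1 b2 b3 : (fun q => vec_monomial b1 b2.+1 b3 q * h q) =
    fun q => quat_real (qx2 q) * (vec_monomial b1 b2 b3 q * h q).
  apply/funext => q; rewrite /vec_monomial mulrA -quat_realM.
  by congr (quat_real _ * _); rewrite exprS; ring.
have vec3 b1 b2 b3 : (fun q => vec_monomial b1 b2 b3.+1 q * h q) =
    fun q => quat_real (qx3 q) * (vec_monomial b1 b2 b3 q * h q).
  apply/funext => q; rewrite /vec_monomial mulrA -quat_realM.
  by congr (quat_real _ * _); rewrite exprS; ring.
(* Splits off one coordinate as the factor f in H^0, leaving degree at most l. If all exponents
   vanish there is nothing to split off and f = 1 is taken; both the base case and the induction
   step use this reduction. *)
have peel l : (forall f b1 b2 b3, Hpoly 0 f -> (b1 + b2 + b3 <= l)%N ->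
      Hpoly l (fun q => f q * (vec_monomial b1 b2 b3 q * h q))) ->
    forall b1 b2 b3, (b1 + b2 + b3 <= l.+1)%N ->
      Hpoly l (fun q => vec_monomial b1 b2 b3 q * h q).
  move=> Hl [|b1] b2 b3 bl; last by rewrite vec1; apply: Hl => //; lia.
  case: b2 bl => [|b2] bl; last by rewrite vec2; apply: Hl => //; lia.
  case: b3 bl => [|b3] bl; last by rewrite vec3; apply: Hl => //; lia.
  have := Hl _ 0%N 0%N 0%N Hpoly0_1 isT; congr (Hpoly l _).
  by apply/funext => q; rewrite mul1r.
elim: k a1 a2 a3 ak => [|k IHk]; apply: peel => f b1 b2 b3 Hf bk; last first.
  by apply: Hpoly0M => //; exact: IHk.
(* For k = 0 no vector coordinate remains, and h, being real, commutes with f. *)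
have := Hpoly0_axialM Ah Hf; congr (Hpoly 0 _); apply/funext => q.
have [-> -> ->] : [/\ b1 = 0, b2 = 0 & b3 = 0]%N by split; lia.
rewrite /vec_monomial !expr0 !mulr1 quat_real1 mul1r (axial_algebra_real Ah).
exact: quat_real_comm.
Qed.

Lemma Hpoly_axial_sum k f : axial_sum R k.+1 f -> Hpoly k f.
Proof.
move=> [h [Ah ->]]; apply: spanH_sum => a1 _; apply: spanH_sum => a2 _.
by apply: spanH_sum => a3 ad; apply: Hpoly_vec_monomialM => //; exact: Ah.
Qed.

Lemma axial_sum_real d f : axial_sum R d f -> f = fun_conj f.
Proof.
pose is_real (p : quat R) := quat_conj p = p.
have realD p q : is_real p -> is_real q -> is_real (p + q).
  move=> hp hq; rewrite /is_real -[in RHS]hp -[in RHS]hq.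
  by apply: quatP => /=; ring.
have real0 : is_real 0 by apply: quatP => //=; exact: oppr0.
have real_realM a b : is_real (quat_real a * quat_real b).
  by rewrite -quat_realM; apply: quatP => //=; exact: oppr0.
move=> [h [Ah ->]]; apply/funext => q; symmetry; rewrite -/(is_real _).
apply: (big_ind is_real) => // a1 _; apply: (big_ind is_real) => // a2 _.
apply: (big_ind is_real) => // a3 ad.
by rewrite (axial_algebra_real (Ah _ _ _ ad)); exact: real_realM.
Qed.

End Words.

Theorem theorem4p11 (R : realType) (k : nat) :
  Hpoly_her R k = axial_sum R k.+1.
Proof.
apply/seteqP; split=> f.
  move=> [Hf f_her]; have [f0 _ _ _] := quat_span_Hpoly Hf.
  (* A hermitian f is pointwise real, so it equals its real component, and the degree bound on that
     component suffices. *)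
  rewrite (_ : f = fun q => quat_real (qx0 (f q))); first exact: axial_sum_span.
  by apply/funext => q; apply: quat_real_re; exact: (congr1 (@^~ q) f_her).
by move=> Sf; split; [exact: Hpoly_axial_sum|exact: axial_sum_real Sf].
Qed.
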